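(* Let $\mathcal{G}$ be a bounded-degree Borel pmp graph on a standard probability space $(X,\mu)$. Then $\chi_\mu^{\mathrm{ap}}(\mathcal{G})\ge\left\lceil 1-\frac{M(T_{\mathcal{G}})}{m(T_{\mathcal{G}})}\right\rceil$.
   Context: A Borel graph on $X$ is a simple undirected graph with Borel edge set; bounded degree means degrees are uniformly bounded (up to null sets). pmp: every partial Borel bijection of $X$ whose graph is contained in the connectedness relation of $\mathcal{G}$ preserves $\mu$. $T_{\mathcal{G}}f(x)=\sum_{y\sim x}f(y)$ on $L^2(X,\mu)$; $M(T)=\sup_{f\ne0}\langle Tf,f\rangle/\langle f,f\rangle$ and $m(T)=\inf_{f\ne0}\langle Tf,f\rangle/\langle f,f\rangle$ are the maximum and minimum of the spectrum. $\chi_\mu^{\mathrm{ap}}(\mathcal{G})$ is the least $k$ such that for every $\varepsilon>0$ there is a Borel $A$ with $\mu(A)>1-\varepsilon$ such that $\mathcal{G}\restriction A$ admits a $\mu$-measurable proper $k$-coloring. *)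

(* Defs.v *)
From HB Require Import structures.
From mathcomp Require Import all_boot all_order all_algebra.
From mathcomp Require Import all_classical all_reals all_analysis.
Set Implicit Arguments. Unset Strict Implicit. Unset Printing Implicit Defensive.
Import Order.TTheory GRing.Theory Num.Theory.
Local Open Scope classical_set_scope.
Local Open Scope ring_scope.

Section Defs.
Context (d : measure_display) (X : measurableType d) (R : realType).

(* Standard Borel space: Borel-isomorphic to a Borel subset of the reals
   (Kuratowski); the isomorphism is measurable, injective, and maps
   measurable sets to measurable sets. *)
Definition standard_borel : Prop :=
  exists phi : X -> R,
    measurable_fun setT phi /\ injective phi /\
    (forall S : set X, measurable S -> measurable (phi @` S)).

Definition borel_graph (E : X -> X -> Prop) : Prop :=
  (forall x y, E x y -> E y x) /\ (forall x, ~ E x x) /\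
  measurable [set p : X * X | E p.1 p.2].

Definition bounded_degree (mu : {measure set X -> \bar R}) (E : X -> X -> Prop)
  : Prop :=
  exists D : nat, {ae mu, forall x, exists s : seq X,
     uniq s /\ (size s <= D)%N /\ (forall y, E x y <-> y \in s)}.

Definition connected (E : X -> X -> Prop) (x y : X) : Prop :=
  exists s : seq X, path (fun a b => `[< E a b >]) x s /\ last x s = y.

Definition partial_borel_bijection (A : set X) (f : X -> X) : Prop :=
  measurable A /\ measurable_fun A f /\ set_inj A f /\
  (forall S, S `<=` A -> measurable S -> measurable (f @` S)).

Definition pmp (mu : {measure set X -> \bar R}) (E : X -> X -> Prop) : Prop :=
  forall A f, partial_borel_bijection A f ->
    (forall x, A x -> connected E x (f x)) ->
    forall S, S `<=` A -> measurable S -> mu (f @` S) = mu S.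

Definition adj_op (E : X -> X -> Prop) (f : X -> R) (x : X) : R :=
  \sum_(y \in [set y | E x y]) f y.

Definition L2_nonzero (mu : {measure set X -> \bar R}) (f : X -> R) : Prop :=
  measurable_fun setT f /\
  mu.-integrable setT (fun x => ((f x) ^+ 2)%:E) /\
  ~ {ae mu, forall x, f x = 0}.

Definition rayleigh_quotients (mu : {measure set X -> \bar R})
  (E : X -> X -> Prop) : set R :=
  [set Rintegral mu setT (fun x => adj_op E f x * f x) /
       Rintegral mu setT (fun x => f x ^+ 2) | f in L2_nonzero mu].

Definition spec_max mu E : R := sup (rayleigh_quotients mu E).
Definition spec_min mu E : R := inf (rayleigh_quotients mu E).

Definition mu_measurable (mu : {measure set X -> \bar R}) (S : set X) : Prop :=
  exists B N : set X, measurable B /\ measurable N /\ mu N = 0%E /\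
    ((S `\` B) `|` (B `\` S)) `<=` N.

Definition measurable_proper_coloring (mu : {measure set X -> \bar R})
  (E : X -> X -> Prop) (A : set X) (k : nat) : Prop :=
  exists c : X -> 'I_k,
    (forall i : 'I_k, mu_measurable mu (A `&` (c @^-1` [set i]))) /\
    (forall x y, A x -> A y -> E x y -> c x <> c y).

(* k witnesses the approximate measurable chromatic number being <= k *)
Definition approx_colorable (mu : {measure set X -> \bar R})
  (E : X -> X -> Prop) (k : nat) : Prop :=
  forall eps : R, 0 < eps -> exists A : set X, measurable A /\
    (1 - eps < fine (mu A))%R /\ measurable_proper_coloring mu E A k.

End Defs.

(* Main.v *)
Require Import Defs.
From HB Require Import structures.
From mathcomp Require Import all_boot all_order all_algebra.
From mathcomp Require Import all_classical all_reals all_analysis.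
From mathcomp Require Import measurable_realfun ring lra.
Set Implicit Arguments. Unset Strict Implicit. Unset Printing Implicit Defensive.
Import Order.TTheory GRing.Theory Num.Theory.
Local Open Scope classical_set_scope.
Local Open Scope ring_scope.

(** Suppose [f] is supported on a set properly coloured by [k] classes, and let
    [f_j] be the restriction of [f] to the [j]-th class.  Then
    [<T f_j, f_j> = 0], so summing
    [m |f - k f_j|^2 <= <T (f - k f_j), f - k f_j>] over [j] gives
    [<T f, f> <= - (k - 1) m |f|^2]; no symmetry of [T] is needed.  For bounded
    [f] and a coloured set [A] of almost full measure, the error made in replacing
    [f] by [f 1_A] is controlled by the form at [t 1_{~A} + 1/t], which dominates
    both [<T 1_{~A}, 1>] and [<T 1, 1_{~A}>] and is itself at most
    [M |t 1_{~A} + 1/t|^2].  Truncation then passes from bounded to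
    square-integrable [f].

    If the Rayleigh quotients are unbounded above or below, then [M] or [m] is the
    junk value [0] of [sup] or [inf], and [M / m = 0].  Hence the boundedness of
    [T], and with it the invariance of [mu], is never used.

    That [T f] is measurable off a null set follows from the measurable projection
    theorem: [{T f > q}], for [f >= 0], is the set of points having finitely many
    distinct neighbours whose [f]-values add up to more than [q]. *)

(** * Measurable projection *)

(** Intersect measurable supersets of [P] whose measures approach the infimum. Cutting [H] by a
    further measurable superset [B] cannot lower its measure below that infimum, so what is cut away
    is null. *)
Lemma measurable_hull (d : measure_display) (X : measurableType d)
    (R : realType) (mu : probability X R) (P : set X) :
  exists H, [/\ measurable H, P `<=` H &
    forall B, measurable B -> P `<=` B -> mu (H `\` B) = 0%E].
Proof.
pose S := [set mu B | B in [set B | measurable B /\ P `<=` B]].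
have S1 : (ereal_inf S <= 1)%E.
  by apply: ereal_inf_lbound; exists setT; rewrite ?probability_setT.
have S0 : (0 <= ereal_inf S)%E.
  by apply: le_ereal_inf_tmp => _ [B _ <-].
have Sfin : ereal_inf S \is a fin_num.
  by rewrite ge0_fin_numE// (le_lt_trans S1)// ltry.
have /choice[B BP] : forall n : nat, exists B,
    [/\ measurable B, P `<=` B & (mu B < ereal_inf S + (n.+1%:R^-1)%:E)%E].
  move=> n; have n0 : 0 < (n.+1%:R^-1 : R) by rewrite invr_gt0.
  have [_ [B [mB PB] <-] ?] := lb_ereal_inf_adherent n0 Sfin.
  by exists B.
have mH : measurable (\bigcap_n B n).
  by apply: bigcapT_measurable => n; have [] := BP n.
exists (\bigcap_n B n); split => //.
  by move=> x Px n _; have [_ + _] := BP n; exact.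
move=> C mC PC.
have muH : (mu (\bigcap_n B n) <= ereal_inf S)%E.
  apply/lee_addgt0Pr => e e0.
  have [n _ /(_ _ (leqnn _)) ne] := near_infty_natSinv_lt (PosNum e0).
  have [mB _ /ltW muB] := BP n.
  apply: le_trans (le_trans muB _); last by rewrite leeD2l// lee_fin ltW.
  by apply: le_measure; rewrite ?inE//; exact: bigcap_inf.
apply/eqP; rewrite -measure_le0 measureD//; last first.
  by rewrite (le_lt_trans muH)// (le_lt_trans S1)// ltry.
rewrite sube_le0 (le_trans muH)//; apply: ereal_inf_lbound.
exists (\bigcap_n B n `&` C) => //; split; first exact: measurableI.
by move=> x Px; split; [move=> n _; have [_ + _] := BP n; exact|exact: PC].
Qed.

Definition finitary (T : Type) (g : (nat -> nat) -> T) :=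
  exists k, forall s t, (forall i, (i < k)%N -> s i = t i) -> g s = g t.

(** For finitary [G n] this is the Souslin operation; letting [G n] read a whole sequence replaces
    the usual indexing by finite sequences. *)
Definition souslin (X : Type) (G : nat -> (nat -> nat) -> set X) : set X :=
  [set x | exists s, forall n, G n s x].

Section Souslin.
Context (d : measure_display) (X : measurableType d) (R : realType)
  (mu : probability X R).

(* Every finite sequence [s] is given a measurable hull [H s] of the points having a
   branch through [s].  Up to a null set [H s] is covered by the hulls of its
   children, so almost every point of [H [::]] can be followed along a branch. *)
Lemma mu_measurable_souslin (G : nat -> (nat -> nat) -> set X) :
  (forall n, finitary (G n)) -> (forall n s, measurable (G n s)) ->
  mu_measurable mu (souslin G).
Proof.
move=> /choice[K GK] mG.
pose P s := [set x | exists2 t, (forall i, (i < size s)%N -> t i = nth 0%N s i) &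
                     forall n, G n t x].
(* [D s] imposes the constraints that the entries of [s] already decide, so the padding by zeros
   does not matter. *)
pose D s := \bigcap_(n in [set n | (K n <= size s)%N]) G n (nth 0%N s).
have mD s : measurable (D s) by exact: bigcap_measurableType.
have PD s : P s `<=` D s.
  move=> x [t st Gt] n /= Kn; rewrite (GK n _ t)// => i iK.
  by rewrite st// (leq_trans iK).
have /choice[H0 H0P] s := measurable_hull mu (P s).
pose H s := H0 s `&` D s.
have mH s : measurable (H s) by apply: measurableI => //; have [] := H0P s.
have PH s : P s `<=` H s.
  by move=> x Px; split; [have [_ + _] := H0P s; exact|exact: PD].
pose N s := H s `\` \bigcup_k H (rcons s k).
have mN s : measurable (N s).
  by apply: measurableD => //; exact: bigcupT_measurable.
have N0 s : mu (N s) = 0%E.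
  apply/eqP; rewrite -measure_le0; have [mH0 _ H0min] := H0P s.
  rewrite -(H0min (\bigcup_k H (rcons s k))).
  - apply: le_measure; rewrite ?inE//.
      by apply: measurableD => //; exact: bigcupT_measurable.
    by apply: setSD => x [].
  - exact: bigcupT_measurable.
  - move=> x [t st Gt]; exists (t (size s)) => //; apply: PH; exists t => // i.
    rewrite size_rcons ltnS leq_eqVlt => /predU1P[->|ilt].
      by rewrite nth_rcons ltnn eqxx.
    by rewrite nth_rcons ilt st.
pose M := \bigcup_i N (odflt [::] (unpickle i)).
have mM : measurable M by apply: bigcupT_measurable => i; exact: mN.
exists (H [::]), M; do 3 split => //.
  apply/negligibleP => //; apply: negligible_bigcup => i.
  by apply/negligibleP; [exact: mN|exact: N0].
move=> x [[[s Gs] nH]|[Hx nP]].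
  by exfalso; apply: nH; apply: PH; exists s.
apply: contrapT => nM; apply: nP.
have step s : H s x -> exists k, H (rcons s k) x.
  move=> Hs; apply: contrapT => nk; apply: nM; exists (pickle s) => //.
  by rewrite pickleK; split => // -[k _ Hk]; apply: nk; exists k.
have /choice[f fP] : forall s, exists k, H s x -> H (rcons s k) x.
  by move=> s; have [/step[k Hk]|nHs] := pselect (H s x); [exists k|exists 0%N].
pose b := fix b n := if n is n'.+1 then rcons (b n') (f (b n')) else [::].
have Hb n : H (b n) x by elim: n => //= n IH; exact: fP.
have sb n : size (b n) = n by elim: n => //= n IH; rewrite size_rcons IH.
have nb m n : (m < n)%N -> nth 0%N (b n) m = f (b m).
  elim: n => // n IH; rewrite ltnS leq_eqVlt => /predU1P[->|mn] /=.
    by rewrite nth_rcons sb ltnn eqxx.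
  by rewrite nth_rcons sb mn IH.
(* At depth [K n] the point lies in [D (b (K n))], and the first [K n] entries of the branch decide
   [G n]. *)
exists (fun m => f (b m)) => n.
have [_ /(_ n)] := Hb (K n); rewrite /= sb => /(_ (leqnn _)).
by rewrite (GK n _ (fun m => f (b m)))// => i /nb.
Qed.

End Souslin.

Definition cylinder : set (set (nat -> nat)) := [set U | finitary U].
(** Baire space with its Borel sigma-algebra: the finitary sets are clopen and include the basic
    open sets. *)
Definition baire := g_sigma_algebraType cylinder.

Section Projection.
Context (d : measure_display) (X : measurableType d).

(** The Souslin operation in the product, each constraint reading only initial segments of [s] and
    [b]. Projecting to [X] then amounts to merging the two sequences. *)
Definition analytic (P : set (X * (nat -> nat))) :=
  exists F : nat -> (nat -> nat) -> (nat -> nat) -> set X,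
  [/\ forall n, exists k, forall s s' b b', (forall i, (i < k)%N -> s i = s' i) ->
        (forall i, (i < k)%N -> b i = b' i) -> F n s b = F n s' b',
      forall n s b, measurable (F n s b) &
      forall x b, P (x, b) <-> exists s, forall n, F n s b x].

Lemma analytic_rect (A : set X) (U : set (nat -> nat)) :
  measurable A -> finitary U -> analytic (A `*` U).
Proof.
move=> mA [k Uk]; exists (fun _ _ b => if `[< U b >] then A else set0); split.
- by move=> _; exists k => _ _ b b' _ bb'; rewrite (Uk b b').
- by move=> _ _ b; case: ifP.
- move=> x b; split; first by move=> [/= Ax Ub] ; exists id => _; rewrite asboolT.
  by move=> [_ /(_ 0%N)]; case: asboolP.
Qed.

(** One sequence codes a witness for every [i], row [i] sitting at the positions [pickle (i, j)];
    the constraints are paired with [i] in the same way. *)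
Lemma analytic_bigcap (P : nat -> set (X * (nat -> nat))) :
  (forall i, analytic (P i)) -> analytic (\bigcap_i P i).
Proof.
move=> /choice[F FP].
exists (fun n s b => if unpickle n is Some (i, m)
                     then F i m (fun j => s (pickle (i, j))) b else setT); split.
- move=> n; case: unpickle => [[i m]|]; last by exists 0%N.
  have [/(_ m)[k Fk] _ _] := FP i.
  (* Constraint [m] of [P i] reads [s] only at the positions [pickle (i, j)] with [j < k]. *)
  exists (maxn k (\max_(j < k) (pickle (i, j : nat)).+1)) => s s' b b' ss' bb'.
  apply: Fk => j jk; last by rewrite bb'// leq_max jk.
  rewrite ss'// leq_max; apply/orP; right.
  exact: (@leq_bigmax _ (fun j : 'I_k => (pickle (i, j : nat)).+1) (Ordinal jk)).
- by move=> n s b; case: unpickle => [[i m]|//]; have [_ + _] := FP i; exact.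
- move=> x b; split=> [Pxb|[s Fs] i _].
    have /choice[s sP] i : exists s, forall n, F i n s b x.
      by have [_ _ FPi] := FP i; apply/FPi/Pxb.
    exists (fun n => if unpickle n is Some (i, j) then s i j else 0%N) => n.
    case: unpickle => [[i m]|//].
    rewrite (_ : (fun j => _) = s i)//.
    by apply/funext => j; rewrite pickleK.
  have [_ _ FPi] := FP i; apply/FPi; exists (fun j => s (pickle (i, j))) => m.
  by have := Fs (pickle (i, m)); rewrite pickleK.
Qed.

(** The entry [s 0] names one of the sets and the tail is a witness for it; the constraints of the
    other sets become vacuous. *)
Lemma analytic_bigcup (P : nat -> set (X * (nat -> nat))) :
  (forall i, analytic (P i)) -> analytic (\bigcup_i P i).
Proof.
move=> /choice[F FP].
exists (fun n s b => if unpickle n is Some (i, m) then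
    if s 0%N == i then F i m (fun j => s j.+1) b else setT else setT); split.
- move=> n; case: unpickle => [[i m]|]; last by exists 0%N.
  have [/(_ m)[k Fk] _ _] := FP i.
  exists k.+1 => s s' b b' ss' bb'; rewrite ss'//; case: ifP => // _.
  by apply: Fk => j jk; [rewrite ss'|rewrite bb'// ltnS ltnW].
- move=> n s b; case: unpickle => [[i m]|//]; case: ifP => // _.
  by have [_ + _] := FP i; exact.
- move=> x b; split=> [[i _ Pxb]|[s Fs]].
    have [_ _ FPi] := FP i; have /FPi[s Fs] := Pxb.
    exists (fun n => if n is n'.+1 then s n' else i) => n.
    case: unpickle => [[j m]|//]; case: eqP => // <-; exact: Fs.
  exists (s 0%N) => //; have [_ _ FPi] := FP (s 0%N); apply/FPi.
  exists (fun j => s j.+1) => m.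
  by have := Fs (pickle (s 0%N, m)); rewrite pickleK eqxx.
Qed.

(** Analytic sets are in general not stable under complement. Asking for both halves restores this,
    and stability under countable unions and intersections then gives a sigma-algebra. *)
Definition bianalytic (P : set (X * (nat -> nat))) := analytic P /\ analytic (~` P).

Lemma sigma_algebra_bianalytic : sigma_algebra setT bianalytic.
Proof.
split.
- split.
    by rewrite -(@setX0 X _ setT); apply: analytic_rect => //; exists 0%N.
  by rewrite setC0 -setXTT; apply: analytic_rect => //; exists 0%N.
- by move=> P [aP aCP]; rewrite setTD; split => //; rewrite setCK.
- move=> P bP; split; first by apply: analytic_bigcup => i; have [] := bP i.
  by rewrite setC_bigcup; apply: analytic_bigcap => i; have [] := bP i.
Qed.

Lemma measurable_bianalytic (P : set (X * baire)) : measurable P -> bianalytic P.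
Proof.
have saB := sigma_algebra_bianalytic.
apply: smallest_sub => // Q [[A mA <-]|[U mU <-]].
  rewrite setTI; split.
    by rewrite -setXT; apply: analytic_rect => //; exists 0%N.
  rewrite (_ : ~` _ = (~` A) `*` setT).
    by apply: analytic_rect; [exact: measurableC|exists 0%N].
  by apply/seteqP; split=> [[x b] /=|[x b] /= []]; tauto.
(* Cylinders only generate the sigma-algebra of the second factor, so the claim is extended from
   them to every measurable [U]. *)
rewrite setTI; move: U mU.
apply: (@smallest_sub _ (sigma_algebra setT) cylinder
  [set U | bianalytic (snd @^-1` U)]).
  have [B0 BC BU] := saB.
  split => /=; first by rewrite preimage_set0.
    by move=> U /BC; rewrite !setTD.
  by move=> U /BU; rewrite preimage_bigcup.
move=> U fU; split.
  by rewrite -setTX; apply: analytic_rect.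
rewrite (_ : ~` _ = setT `*` (~` U)).
  apply: analytic_rect => //; have [k Uk] := fU; exists k => s t st.
  by rewrite /setC /= (Uk s t).
by apply/seteqP; split=> [[x b] /=|[x b] /= []]; tauto.
Qed.

(** Interleave: the even entries of one sequence carry the Souslin witness and the odd ones carry
    [b], so the projection is itself a Souslin set. *)
Lemma mu_measurable_projection (R : realType) (mu : probability X R)
    (P : set (X * baire)) :
  measurable P -> mu_measurable mu [set x | exists b, P (x, b)].
Proof.
move=> /measurable_bianalytic[[F [Fk mF FP]] _].
pose G n (t : nat -> nat) := F n (fun i => t i.*2) (fun i => t i.*2.+1).
rewrite (_ : mkset _ = souslin G).
  apply: mu_measurable_souslin => [n|n s]; last exact: mF.
  have [k Fkn] := Fk n; exists k.*2 => s t st.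
  apply: Fkn => i ik; rewrite st ?ltn_double//.
  by rewrite -[i.*2.+2]/(i.+1.*2) leq_double.
apply/seteqP; split=> x /=.
  move=> [b /FP[s Fs]].
  exists (fun i => if odd i then b i./2 else s i./2) => n.
  rewrite /G (_ : (fun i => _) = s); last first.
    by apply/funext => i; rewrite odd_double doubleK.
  rewrite (_ : (fun i => _) = b)//.
  by apply/funext => i /=; rewrite odd_double uphalf_double.
move=> [t Gt]; exists (fun i => t i.*2.+1); apply/FP.
by exists (fun i => t i.*2).
Qed.

End Projection.

Lemma measurable_finitary (d : measure_display) (T : measurableType d)
    (g : baire -> T) : finitary g -> measurable_fun setT g.
Proof.
move=> [k gk] _ Y _; rewrite setTI; apply: sub_sigma_algebra.
by exists k => s t /gk st; rewrite /preimage /= st.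
Qed.

Lemma measurable_reindex (g : nat -> nat) :
  measurable_fun setT (fun b : baire => (fun n => b (g n)) : baire).
Proof.
apply: (@measurability _ _ baire baire setT
  (fun b : baire => (fun n => b (g n)) : baire) cylinder erefl _).
move=> _ [U [k Uk] <-].
rewrite setTI; apply: sub_sigma_algebra.
exists (\max_(j < k) (g j).+1) => s t st; rewrite /preimage /=; apply: Uk => j jk.
apply: st; exact: (@leq_bigmax _ (fun j : 'I_k => (g j).+1) (Ordinal jk)).
Qed.

(** A sequence is sent to the supremum of the rationals coded by its entries from index 1 on. Entry
    0 caps them, so that the supremum is always that of a bounded set; to reach [t], the cap is
    taken above [|t|]. *)
Lemma baire_real_surjection (R : realType) : exists s : baire -> R,
  measurable_fun setT s /\ forall t, exists b, s b = t.
Proof.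
pose r (n : nat) : R := ratr (odflt 0%Q (unpickle n)).
pose h n (b : baire) : R := Num.min (r (b n.+1)) (b 0%N)%:R.
have ubh b : ubound (range (h^~ b)) (b 0%N)%:R.
  by move=> _ [n _ <-]; rewrite /h ge_min lexx orbT.
exists (fun b => sups (h^~ b) 0); split.
  apply: measurable_fun_sups => [b _|m]; first by exists (b 0%N)%:R.
  by apply: measurable_finitary; exists m.+2 => s t st; rewrite /h !st.
move=> t.
have /choice[q qP] (n : nat) : exists q : nat, t - n.+1%:R^-1 < r q < t.
  have : t - n.+1%:R^-1 < t by rewrite ltrBlDr ltrDl.
  by move=> /rat_in_itvoo[q]; rewrite in_itv/= => qt; exists (pickle q); rewrite /r pickleK.
pose b n := if n is n'.+1 then q n' else (Num.trunc `|t|).+1.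
have hb n : h n b = r (q n).
  rewrite /h /=; apply/min_idPl; have /andP[_ /ltW qt] := qP n.
  apply: le_trans qt (le_trans (ler_norm t) _).
  by rewrite ltW// truncnS_gt.
exists b; have -> : sups (h^~ b) 0 = sup (range (r \o q)).
  congr sup; rewrite /sdrop.
  by apply/seteqP; split=> _ [n _ <-]; exists n => //=; rewrite hb.
apply/eqP; rewrite eq_le; apply/andP; split.
  apply: ge_sup; first by exists (r (q 0%N)), 0%N.
  by move=> _ [n _ <-]; have /andP[_ /ltW] := qP n.
apply/ler_addgt0Pr => e e0.
have [n _ /(_ _ (leqnn _)) /ltW ne] := near_infty_natSinv_lt (PosNum e0).
have /andP[/ltW tq _] := qP n.
rewrite -lerBlDr (le_trans _ (le_trans tq _))//; first by rewrite lerB.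
apply: ub_le_sup; last by exists n.
by exists t => _ [m _ <-]; have /andP[_ /ltW] := qP m.
Qed.

Section StandardBorel.
Context (d : measure_display) (X : measurableType d) (R : realType).
Hypothesis sX : standard_borel X R.

(** A single element of Baire space codes a whole sequence of points: its [i]-th row codes a real,
    which a Borel left inverse of [phi] sends to the [i]-th point. *)
Lemma standard_borel_surjections : exists theta : nat -> baire -> X,
  (forall i, measurable_fun setT (theta i)) /\
  forall y : nat -> X, exists b, forall i, theta i b = y i.
Proof.
have [phi [mphi [iphi imphi]]] := sX.
have [s [ms ss]] := baire_real_surjection R.
(* [psi] inverts [phi] on its range and is constant elsewhere. It is Borel because [phi] maps
   measurable sets to measurable sets. *)
have /choice[psi psiP] (t : R) : exists x, (range phi t -> phi x = t) /\
    (~ range phi t -> x = point).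
  have [[x _ xt]|nt] := pselect (range phi t); last by exists point.
  by exists x; split => // -[]; exists x.
have psiK x : psi (phi x) = x.
  by apply: iphi; have [+ _] := psiP (phi x); apply; exists x.
have mrange : measurable (range phi) by exact: imphi.
have mpsi : measurable_fun setT psi.
  move=> _ Y mY; rewrite setTI.
  rewrite (_ : _ @^-1` _ = phi @` Y `|` (~` range phi `&` [set t | Y point])).
    apply: measurableU; first exact: imphi.
    apply: measurableI; first exact: measurableC.
    have [Yp|nYp] := pselect (Y point); first by rewrite (_ : mkset _ = setT)// -subTset.
    by rewrite (_ : mkset _ = set0)// -subset0.
  apply/seteqP; split=> t /=.
    have [[x _ <-]|nt] := pselect (range phi t).
      by rewrite psiK => Yx; left; exists x.
    by have [_ /(_ nt)->] := psiP t; right.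
  move=> [[x Yx <-]|[nt Yp]]; first by rewrite psiK.
  by have [_ /(_ nt)->] := psiP t.
exists (fun i b => psi (s (fun n => b (pickle (i, n))))); split.
  move=> i; apply: measurableT_comp => //.
  exact: (measurableT_comp ms (measurable_reindex _)).
move=> y; have /choice[b bP] i : exists b, s b = phi (y i) by exact: ss.
exists (fun n => if unpickle n is Some (i, m) then b i m else 0%N) => i.
rewrite (_ : (fun n => _) = b i) ?bP ?psiK//.
by apply/funext => n; rewrite pickleK.
Qed.

End StandardBorel.

(** * Measurability of the adjacency operator *)

Lemma ler_sum_subseq (T : eqType) (R : realType) (f : T -> R) (s t : seq T) :
  (forall x, 0 <= f x) -> uniq s -> uniq t -> {subset t <= s} ->
  \sum_(x <- t) f x <= \sum_(x <- s) f x.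
Proof.
move=> f0 us ut ts; rewrite [leRHS](bigID (mem t))/= -[leLHS]addr0.
apply: lerD; last by apply: sumr_ge0.
rewrite -[leRHS]big_filter (perm_big [seq x <- s | x \in t])//.
apply: uniq_perm => //; first exact: filter_uniq.
move=> x; rewrite mem_filter; case: (boolP (x \in t)) => //= /ts.
by move=> ->.
Qed.

Section AeMeasurable.
Context (d : measure_display) (X : measurableType d) (R : realType)
  (mu : probability X R).

(** The measure is not assumed complete, so a function controlled only up to a null set is handled
    through its restriction to a conull measurable set. *)
Definition ae_measurable (u : X -> R) := exists N : set X,
  [/\ measurable N, mu N = 0%E & measurable_fun (~` N) u].

Lemma mu_measurable_bigcup (S : nat -> set X) :
  (forall n, mu_measurable mu (S n)) -> mu_measurable mu (\bigcup_n S n).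
Proof.
move=> /choice[B /choice[N BN]].
have mN : measurable (\bigcup_n N n).
  by apply: bigcupT_measurable => n; have [_ []] := BN n.
exists (\bigcup_n B n), (\bigcup_n N n); split.
  by apply: bigcupT_measurable => n; have [] := BN n.
split => //; split.
  apply/negligibleP => //; apply: negligible_bigcup => n.
  by have [_ [mNn [N0 _]]] := BN n; apply/negligibleP.
move=> x [[[n _ Sx] nB]|[[n _ Bx] nS]]; exists n => //;
  have [_ [_ [_ sN]]] := BN n; apply: sN; [left|right]; split => //.
  by move=> Bx; apply: nB; exists n.
by move=> Sx; apply: nS; exists n.
Qed.

(** Each [S q] brings its own null set. Only rational levels are used, since [{u > q}] is the union
    of the [{u > r}] over rationals [r >= q], so the union of these null sets is null. *)
Lemma ae_measurable_ray (N0 : set X) (S : R -> set X) (u : X -> R) :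
  measurable N0 -> mu N0 = 0%E -> (forall q, mu_measurable mu (S q)) ->
  (forall x q, ~ N0 x -> S q x <-> q < u x) -> ae_measurable u.
Proof.
move=> mN0 N00 mS Su; pose r n : R := ratr (odflt 0%Q (unpickle n)).
have /choice[B /choice[N BN]] n := mS (r n).
have mN : measurable (\bigcup_n N n).
  by apply: bigcupT_measurable => n; have [_ []] := BN n.
have NN0 : mu (\bigcup_n N n) = 0%E.
  apply/negligibleP => //; apply: negligible_bigcup => n.
  by have [_ [mNn [Nn0 _]]] := BN n; apply/negligibleP.
exists (N0 `|` \bigcup_n N n); split.
- exact: measurableU.
- exact: null_set_setU.
- move=> mD; apply: (measurability _ (RGenOInfty.measurableE R)) => //.
  move=> _ [_ [q ->] <-]; set D := ~` _ in mD *.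
  rewrite (_ : _ `&` _ = D `&` \bigcup_(n in [set n | q <= r n]) B n).
    apply: measurableI => //; apply: bigcup_measurable => n _.
    by have [] := BN n.
  have BD n x : D x -> B n x <-> r n < u x.
    move=> /not_orP[nN0 nN]; rewrite -(Su x (r n) nN0).
    have [_ [_ [_ sN]]] := BN n.
    split=> [Bx|Sx]; apply: contrapT => nx; apply: nN; exists n => //; apply: sN.
      by right.
    by left.
  apply/seteqP; split=> x [Dx].
    rewrite /= in_itv/= andbT => /rat_in_itvoo[p]; rewrite in_itv/= => /andP[qp pu].
    split => //; exists (pickle p); first by rewrite /r /= pickleK ltW.
    by apply/BD => //; rewrite /r pickleK.
  move=> [n /= qn /(BD _ _ Dx) nu]; split => //=.
  by rewrite in_itv/= andbT (le_lt_trans qn).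
Qed.

Lemma ae_measurableB (u v : X -> R) : ae_measurable u -> ae_measurable v ->
  ae_measurable (fun x => u x - v x).
Proof.
move=> [N [mN N0 mu_]] [M [mM M0 mv]]; exists (N `|` M); split.
- exact: measurableU.
- exact: null_set_setU.
- by apply: measurable_funB; [apply: measurable_funS mu_|apply: measurable_funS mv];
    rewrite ?setCU//; exact: measurableC.
Qed.

Lemma ae_measurable_eq (N0 : set X) (u v : X -> R) :
  measurable N0 -> mu N0 = 0%E -> (forall x, ~ N0 x -> u x = v x) ->
  ae_measurable u -> ae_measurable v.
Proof.
move=> mN0 N00 uv [N [mN NN mu_]]; exists (N `|` N0); split.
- exact: measurableU.
- exact: null_set_setU.
- apply: (@eq_measurable_fun _ _ _ _ _ u).
    by move=> x; rewrite inE setCU => -[_ /uv].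
  by apply: measurable_funS mu_; rewrite ?setCU//; exact: measurableC.
Qed.

End AeMeasurable.

Section AdjOp.
Context (d : measure_display) (X : measurableType d) (R : realType)
  (mu : probability X R) (E : X -> X -> Prop).
Hypothesis sX : standard_borel X R.
Hypothesis bE : borel_graph E.

Lemma adj_op_seq (f : X -> R) (x : X) (s : seq X) :
  uniq s -> (forall y, E x y <-> y \in s) -> adj_op E f x = \sum_(y <- s) f y.
Proof.
move=> us Es; rewrite fsbig_seq// /adj_op.
suff -> : [set y | E x y] = [set` s] by [].
by apply/seteqP; split=> y /Es.
Qed.

(** Only the first [n] terms of [y] matter; an infinite sequence is used so that one element of
    Baire space can code it. *)
Definition neighbour_sum_gt (f : X -> R) (q : R) (n : nat) : set X :=
  [set x | exists y : nat -> X, [/\ forall i, (i < n)%N -> E x (y i),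
     forall i j, (i < j < n)%N -> y i <> y j & q < \sum_(i < n) f (y i)]].

Lemma mu_measurable_neighbour_sum_gt (f : X -> R) (q : R) (n : nat) :
  measurable_fun setT f -> mu_measurable mu (neighbour_sum_gt f q n).
Proof.
move=> mf; have [theta [mth sth]] := standard_borel_surjections sX.
have [phi [mphi [iphi _]]] := sX; have [_ [_ mE]] := bE.
(* Distinctness is tested on the images under the injection [phi], since inequality of reals is a
   measurable condition. *)
pose P : set (X * baire) :=
  \bigcap_(i in [set i | (i < n)%N]) [set p | E p.1 (theta i p.2)] `&`
  \bigcap_i \bigcap_(j in [set j | (i < j < n)%N])
    [set p | phi (theta i p.2) != phi (theta j p.2)] `&`
  [set p | q < \sum_(i < n) f (theta i p.2)].
have mth2 i : measurable_fun setT (fun p : X * baire => theta i p.2).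
  exact: measurableT_comp.
have mP : measurable P.
  apply: measurableI; first apply: measurableI.
  - apply: bigcap_measurableType => i _; rewrite -[mkset _]setTI.
    exact: (measurable_fun_pair measurable_fst (mth2 i) measurableT mE).
  - apply: bigcapT_measurable => i; apply: bigcap_measurableType => j _.
    have mb : measurable_fun setT
        (fun p : X * baire => phi (theta i p.2) == phi (theta j p.2)).
      by apply: measurable_fun_eqr; exact: measurableT_comp.
    have := mb measurableT [set false] I.
    rewrite setTI preimage_false; set A := ~` _; set B := mkset _.
    suff -> : A = B by [].
    by apply/funext => p; rewrite propeqE; split=> /negP.
  - have ms : measurable_fun setT (fun p : X * baire => \sum_(i < n) f (theta i p.2)).
      by apply: measurable_sum => i; exact: measurableT_comp.
    have := ms measurableT `]q, +oo[%classic (measurable_itv _).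
    by rewrite setTI preimage_itvoy.
have := mu_measurable_projection mu mP; congr mu_measurable.
apply/seteqP; split=> x.
  move=> [b [[Eb db] qb]]; exists (fun i => theta i b); split => // i j ij th.
  by have := db i I j ij; rewrite /= th eqxx.
move=> [y [Ey dy qy]]; have [b by_] := sth y; exists b; split.
  split=> [i /=|i _ j ij /=]; rewrite !by_; first exact: Ey.
  by apply/eqP => /iphi; exact: dy.
by rewrite /=; under eq_bigr do rewrite by_.
Qed.

(** For [f >= 0], a sum over distinct neighbours never exceeds the full sum, and the full sum is one
    of these. *)
Lemma adj_op_gt (f : X -> R) (x : X) (s : seq X) (q : R) :
  (forall y, 0 <= f y) -> uniq s -> (forall y, E x y <-> y \in s) ->
  (\bigcup_n neighbour_sum_gt f q n) x <-> q < adj_op E f x.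
Proof.
move=> f0 us Es; rewrite (adj_op_seq f us Es); split.
  move=> [n _ [y [Ey dy /lt_le_trans]]]; apply.
  rewrite -(big_mkord xpredT (fun i => f (y i))) -(big_map y xpredT f).
  apply: ler_sum_subseq => //.
    rewrite map_inj_in_uniq ?iota_uniq// => i j; rewrite !mem_index_iota/= => i_n jn yij.
    case: (ltngtP i j) => // ij; exfalso.
      by apply: (dy i j) => //; rewrite ij.
    by apply: (dy j i) => //; rewrite ij.
  by move=> _ /mapP[i + ->]; rewrite mem_index_iota => /andP[_ /Ey/Es].
move=> qs; exists (size s) => //; exists (nth x s); split.
- by move=> i i_s; apply/Es/mem_nth.
- move=> i j /andP[ij js] /eqP; rewrite nth_uniq// ?(ltn_trans ij)//.
  by move=> /eqP ij'; move: ij; rewrite ij' ltnn.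
- by rewrite (big_nth x) big_mkord in qs.
Qed.

Hypothesis dE : bounded_degree mu E.

Lemma ae_measurable_adj_op (f : X -> R) :
  measurable_fun setT f -> ae_measurable mu (adj_op E f).
Proof.
move=> mf; have [D [N [mN N0 DN]]] := dE.
have sP x : ~ N x -> exists2 s : seq X, uniq s & forall y, E x y <-> y \in s.
  move=> Nx; have [s [us [_ Es]]] : exists s : seq X,
    uniq s /\ (size s <= D)%N /\ (forall y, E x y <-> y \in s).
    by apply: contrapT => h; apply: Nx; exact: DN.
  by exists s.
(* Superlevel sets are described by partial sums only for nonnegative functions; [f] is then
   recovered from its positive and negative parts. *)
have pos (g : X -> R) : measurable_fun setT g -> (forall x, 0 <= g x) ->
    ae_measurable mu (adj_op E g).
  move=> mg g0.
  apply: (@ae_measurable_ray _ _ _ _ N (fun q => \bigcup_n neighbour_sum_gt g q n)) => //.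
    by move=> q; apply: mu_measurable_bigcup => n; exact: mu_measurable_neighbour_sum_gt.
  by move=> x q /sP[s us Es]; exact: adj_op_gt us Es.
apply: (@ae_measurable_eq _ _ _ _ N
  (fun x => adj_op E f^\+ x - adj_op E f^\- x)) => //.
  move=> x /sP[s us Es]; rewrite !(adj_op_seq _ us Es) -sumrB.
  by apply: eq_bigr => y _; rewrite -[in RHS](funrposBneg f).
by apply: ae_measurableB; apply: pos => [|x]; rewrite ?funrpos_ge0 ?funrneg_ge0//;
  [exact: measurable_funrpos|exact: measurable_funrneg].
Qed.

End AdjOp.

(** * Integration modulo null sets *)

Section NullSets.
Import HBNNSimple.
Context (d : measure_display) (X : measurableType d) (R : realType)
  (mu : {measure set X -> \bar R}).

Lemma ge0_integral_setC_null (N : set X) (u : X -> \bar R) :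
  measurable N -> mu N = 0%E -> (forall x, 0 <= u x)%E ->
  (\int[mu]_x u x = \int[mu]_(x in ~` N) u x)%E.
Proof.
move=> mN N0 u0; rewrite ge0_integralTE// ge0_integralE//.
have mCN := measurableC mN.
apply/eqP; rewrite eq_le; apply/andP; split; apply: ge_ereal_sup.
  (* A simple function below [u], cut off on [N], lies below the restriction of [u] and has the same
     integral. *)
  move=> _ [h hu <-]; apply: ereal_sup_ubound.
  have projE x : proj_nnsfun h mCN x = h x * (x \in ~` N)%:R by [].
  exists (proj_nnsfun h mCN).
    move=> x; rewrite projE /patch; case: ifPn => /= _.
      by rewrite mulr1; exact: hu.
    by rewrite mulr0.
  rewrite -(integralT_nnsfun mu h) (ge0_negligible_integral mN)//.
  - rewrite setTD integral_nnsfun//; apply: eq_sintegral => x.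
    by rewrite projE /patch; case: ifPn => _; rewrite ?mulr1 ?mulr0.
  - exact/measurable_EFinP.
  - by move=> x _; rewrite lee_fin.
move=> _ [h hu <-]; apply: ereal_sup_ubound; exists h => // x.
apply: le_trans (hu x) _.
by rewrite /patch; case: ifPn.
Qed.

(* [u] need not be measurable: the integral is a supremum over simple functions,
   which can be cut off on [N]. *)
Lemma integral_setC_null (N : set X) (u : X -> \bar R) :
  measurable N -> mu N = 0%E ->
  (\int[mu]_x u x = \int[mu]_(x in ~` N) u x)%E.
Proof.
move=> mN N0; rewrite integralE [RHS]integralE.
by rewrite !(ge0_integral_setC_null mN N0).
Qed.

Lemma Rintegral_setC_null (N : set X) (u : X -> R) :
  measurable N -> mu N = 0%E ->
  Rintegral mu setT u = Rintegral mu (~` N) u.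
Proof. by move=> mN N0; rewrite /Rintegral (integral_setC_null _ mN N0). Qed.

End NullSets.

Section AeIntegrable.
Context (d : measure_display) (X : measurableType d) (R : realType)
  (mu : probability X R).
Implicit Types u v : X -> R.

(** By [Rintegral_setC_null] the integral over the whole space is still additive, homogeneous and
    monotone on this class. *)
Definition ae_integrable u := exists N : set X,
  [/\ measurable N, mu N = 0%E & mu.-integrable (~` N) (EFin \o u)].

Local Notation integral u := (Rintegral mu setT u).

Lemma ae_integrable2 u v : ae_integrable u -> ae_integrable v ->
  exists N : set X, [/\ measurable N, mu N = 0%E,
    mu.-integrable (~` N) (EFin \o u) & mu.-integrable (~` N) (EFin \o v)].
Proof.
move=> [N [mN N0 iu]] [M [mM M0 iv]]; exists (N `|` M); split.
- exact: measurableU.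
- exact: null_set_setU.
- by apply: integrableS iu; rewrite ?setCU//; [exact: measurableC|apply: measurableI; exact: measurableC].
- by apply: integrableS iv; rewrite ?setCU//; [exact: measurableC|apply: measurableI; exact: measurableC].
Qed.

Lemma ae_integrableD u v : ae_integrable u -> ae_integrable v ->
  ae_integrable (fun x => u x + v x).
Proof.
move=> iu iv; have [N [mN N0 {}iu {}iv]] := ae_integrable2 iu iv.
exists N; split => //; have mC := measurableC mN.
by have := integrableD mC iu iv.
Qed.

Lemma ae_integrableZ (a : R) u : ae_integrable u -> ae_integrable (fun x => a * u x).
Proof.
move=> [N [mN N0 iu]]; exists N; split => //; have mC := measurableC mN.
by have := integrableZl mC a iu.
Qed.

Lemma integral_aeD u v : ae_integrable u -> ae_integrable v ->
  integral (fun x => u x + v x) = integral u + integral v.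
Proof.
move=> iu iv; have [N [mN N0 {}iu {}iv]] := ae_integrable2 iu iv.
rewrite !(Rintegral_setC_null _ mN N0) RintegralD//; exact: measurableC.
Qed.

Lemma integral_aeZ (a : R) u : ae_integrable u ->
  integral (fun x => a * u x) = a * integral u.
Proof.
move=> [N [mN N0 iu]].
rewrite !(Rintegral_setC_null _ mN N0) RintegralZl//; exact: measurableC.
Qed.

Lemma eq_integral_ae (N : set X) u v : measurable N -> mu N = 0%E ->
  (forall x, ~ N x -> u x = v x) -> integral u = integral v.
Proof.
move=> mN N0 uv; rewrite !(Rintegral_setC_null _ mN N0).
by apply: eq_Rintegral => x; rewrite inE => /uv.
Qed.

Lemma le_integral_ae (N : set X) u v : measurable N -> mu N = 0%E ->
  ae_integrable u -> ae_integrable v -> (forall x, ~ N x -> u x <= v x) ->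
  integral u <= integral v.
Proof.
move=> mN N0 iu iv uv; have [M [mM M0 {}iu {}iv]] := ae_integrable2 iu iv.
have mNM : measurable (N `|` M) by exact: measurableU.
have NM0 : mu (N `|` M) = 0%E by exact: null_set_setU.
have mC := measurableC mNM.
rewrite !(Rintegral_setC_null _ mNM NM0); apply: le_Rintegral => //.
- by apply: integrableS iu => //; rewrite ?setCU//; exact: measurableC.
- by apply: integrableS iv => //; rewrite ?setCU//; exact: measurableC.
- by move=> x; rewrite setCU => -[/uv].
Qed.

Lemma ae_integrable_bounded (N : set X) u (C : R) : measurable N -> mu N = 0%E ->
  ae_measurable mu u -> (forall x, ~ N x -> `|u x| <= C) -> ae_integrable u.
Proof.
move=> mN N0 [M [mM M0 mu_]] uC; exists (N `|` M); split.
- exact: measurableU.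
- exact: null_set_setU.
have mNM : measurable (N `|` M) by exact: measurableU.
have mC := measurableC mNM.
apply: (@le_integrable _ _ _ _ _ mC _ (EFin \o cst C)).
- apply/measurable_EFinP; apply: measurable_funS mu_; first exact: measurableC.
  by rewrite setCU.
- move=> x; rewrite setCU => -[/uC uxC _] /=.
  by rewrite lee_fin (le_trans uxC)// ler_norm.
- apply: (@integrableS _ _ _ _ setT) => //.
  exact: finite_measure_integrable_cst.
Qed.

Lemma ae_measurableM u v : ae_measurable mu u -> measurable_fun setT v ->
  ae_measurable mu (fun x => u x * v x).
Proof.
move=> [N [mN N0 mu_]] mv; exists N; split => //.
by apply: measurable_funM => //; exact: measurable_funTS.
Qed.

End AeIntegrable.

(** * The quadratic form of the adjacency operator *)

Section BoundedMeasurable.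
Context (d : measure_display) (X : measurableType d) (R : realType).
Implicit Types f g : X -> R.

Definition bounded_measurable f :=
  measurable_fun setT f /\ exists C, forall x, `|f x| <= C.

Lemma bounded_measurable_cst (a : R) : bounded_measurable (fun=> a).
Proof. by split => //; exists `|a|. Qed.

Lemma bounded_measurable_indic (A : set X) :
  measurable A -> bounded_measurable (\1_A : X -> R).
Proof.
move=> mA; split; first exact: measurable_indic.
by exists 1 => x; rewrite indicE; case: (_ \in _); rewrite ?normr1 ?normr0.
Qed.

Lemma bounded_measurableD f g : bounded_measurable f -> bounded_measurable g ->
  bounded_measurable (fun x => f x + g x).
Proof.
move=> [mf [C fC]] [mg [C' gC]]; split; first exact: measurable_funD.
by exists (C + C') => x; rewrite (le_trans (ler_normD _ _))// lerD.
Qed.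

Lemma bounded_measurableM f g : bounded_measurable f -> bounded_measurable g ->
  bounded_measurable (fun x => f x * g x).
Proof.
move=> [mf [C fC]] [mg [C' gC]]; split; first exact: measurable_funM.
by exists (C * C') => x; rewrite normrM ler_pM.
Qed.

End BoundedMeasurable.

Section QuadraticForm.
Context (d : measure_display) (X : measurableType d) (R : realType)
  (mu : probability X R) (E : X -> X -> Prop).
Hypothesis sX : standard_borel X R.
Hypothesis bE : borel_graph E.
Hypothesis dE : bounded_degree mu E.
Implicit Types f g h : X -> R.

Local Notation integral u := (Rintegral mu setT u).
Local Notation form f := (integral (fun x => adj_op E f x * f x)).
Local Notation sqnorm f := (integral (fun x => f x ^+ 2)).

(** The list at [x] serves every [f] at once, so off a single null set the operator is a finite sum,
    linear pointwise. *)
Lemma ae_finite_degree : exists (D : nat) (N : set X),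
  [/\ measurable N, mu N = 0%E & forall x, ~ N x -> exists s : seq X,
    [/\ forall y, y \in s -> E x y, (size s <= D)%N &
        forall f, adj_op E f x = \sum_(y <- s) f y]].
Proof.
have [D [N [mN N0 DN]]] := dE; exists D, N; split => // x Nx.
have [s [us [sD Es]]] : exists s : seq X,
  uniq s /\ (size s <= D)%N /\ (forall y, E x y <-> y \in s).
  by apply: contrapT => h; apply: Nx; exact: DN.
by exists s; split => // [y /Es//|f]; exact: adj_op_seq.
Qed.

Lemma ae_integrable_bm f : bounded_measurable f -> ae_integrable mu f.
Proof.
move=> [mf [C fC]]; apply: (@ae_integrable_bounded _ _ _ _ set0 _ C) => //.
by exists set0; split => //; exact: measurable_funTS.
Qed.

Lemma ae_integrable_form f g : bounded_measurable f -> bounded_measurable g ->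
  ae_integrable mu (fun x => adj_op E f x * g x).
Proof.
move=> [mf [C fC]] [mg [C' gC]]; have [D [N [mN N0 DN]]] := ae_finite_degree.
apply: (@ae_integrable_bounded _ _ _ _ N _ (D%:R * C * C')) => //.
  by apply: ae_measurableM => //; exact: ae_measurable_adj_op.
move=> x /DN[s [_ sD ->]]; rewrite normrM ler_pM//.
have C0 : 0 <= C by exact: le_trans (fC x).
apply: le_trans (ler_norm_sum _ _ _) _.
apply: (@le_trans _ _ (\sum_(y <- s) C)); first by apply: ler_sum.
by rewrite big_const_seq count_predT iter_addr_0 -[C *+ _]mulr_natl ler_wpM2r// ler_nat.
Qed.

Lemma integral_ae_sum (k : nat) (u : 'I_k -> X -> R) :
  (forall j, ae_integrable mu (u j)) ->
  ae_integrable mu (fun x => \sum_j u j x) /\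
  integral (fun x => \sum_j u j x) = \sum_j integral (u j).
Proof.
move=> iu; elim: (index_enum _) => [|j s [IH1 IH2]].
  under eq_fun do rewrite big_nil.
  by rewrite big_nil Rintegral_cst// mul0r; split => //;
    exact/ae_integrable_bm/bounded_measurable_cst.
under eq_fun do rewrite big_cons.
by rewrite big_cons -IH2 integral_aeD//; split => //; exact: ae_integrableD.
Qed.

Lemma sqnorm_eq0 f : measurable_fun setT f ->
  mu.-integrable setT (fun x => (f x ^+ 2)%:E) -> sqnorm f = 0 ->
  {ae mu, forall x, f x = 0}.
Proof.
move=> mf if2 f0.
have /ae_eq_integral_abs : (\int[mu]_x `|(f x ^+ 2)%:E| = 0)%E.
  under eq_integral do rewrite gee0_abs ?lee_fin ?sqr_ge0//.
  rewrite -[LHS]fineK ?integrable_fin_num//.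
  by move: f0; rewrite /Rintegral => ->.
move=> /(_ measurableT (measurable_int _ if2)).
apply: filterS => x /(_ I) /= [] /eqP; rewrite sqrf_eq0 => /eqP.
exact.
Qed.

Lemma form_bounds f : bounded_measurable f ->
  has_lbound (rayleigh_quotients mu E) -> has_ubound (rayleigh_quotients mu E) ->
  spec_min mu E * sqnorm f <= form f <= spec_max mu E * sqnorm f.
Proof.
move=> bf lbR ubR; have [mf _] := bf.
have if2 : mu.-integrable setT (fun x => (f x ^+ 2)%:E).
  have [N [mN N0 iN]] := ae_integrable_bm (bounded_measurableM bf bf).
  have [_ [C fC]] := bf.
  apply: (@le_integrable _ _ _ _ _ measurableT _ (EFin \o cst (C ^+ 2))).
  - by apply/measurable_EFinP; exact: measurable_funX.
  - move=> x _ /=; rewrite lee_fin !normrX ler_pXn2r ?nnegrE//.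
    by rewrite (le_trans (fC x))// ler_norm.
  - exact: finite_measure_integrable_cst.
(* An [f] vanishing almost everywhere has no Rayleigh quotient; there the factor [f x] makes all
   three terms zero. *)
have [f0|nf0] := pselect {ae mu, forall x, f x = 0}.
  have [N [mN N0 fN]] := f0.
  have fx x : ~ N x -> f x = 0 by move=> Nx; apply: contrapT => fx0; apply: Nx; exact: fN.
  have z : integral (fun _ : X => 0) = 0 :> R by rewrite Rintegral_cst// mul0r.
  have -> : form f = 0.
    by rewrite -[RHS]z; apply: (eq_integral_ae mN N0) => x /fx ->; rewrite mulr0.
  have -> : sqnorm f = 0.
    by rewrite -[RHS]z; apply: (eq_integral_ae mN N0) => x /fx ->; rewrite expr0n.
  by rewrite !mulr0 lexx.
have Q0 : 0 < sqnorm f.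
  rewrite lt_def Rintegral_ge0 ?andbT; last by move=> x _; exact: sqr_ge0.
  by apply/eqP => /(sqnorm_eq0 mf if2).
have Rf : rayleigh_quotients mu E (form f / sqnorm f) by exists f.
apply/andP; split.
  by rewrite -ler_pdivlMr//; exact: ge_inf.
by rewrite -ler_pdivrMr//; exact: ub_le_sup.
Qed.

End QuadraticForm.

(** * The form on coloured sets, and the removal of a small set *)

Section ColoredForm.
Context (d : measure_display) (X : measurableType d) (R : realType)
  (mu : probability X R) (E : X -> X -> Prop).
Hypothesis sX : standard_borel X R.
Hypothesis bE : borel_graph E.
Hypothesis dE : bounded_degree mu E.
Hypothesis lbR : has_lbound (rayleigh_quotients mu E).
Hypothesis ubR : has_ubound (rayleigh_quotients mu E).
Implicit Types f g h : X -> R.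

Local Notation integral u := (Rintegral mu setT u).
Local Notation form f := (integral (fun x => adj_op E f x * f x)).
Local Notation sqnorm f := (integral (fun x => f x ^+ 2)).

Lemma integral_cst_proba (a : R) : integral (fun _ : X => a) = a.
Proof. by rewrite Rintegral_cst//; rewrite [X in fine X]probability_setT mulr1. Qed.

Lemma form_colored (k : nat) (A : set X) (c : X -> 'I_k) f : (0 < k)%N ->
  (forall j, measurable (A `&` c @^-1` [set j])) ->
  (forall x y, A x -> A y -> E x y -> c x <> c y) ->
  bounded_measurable f -> (forall x, ~ A x -> f x = 0) ->
  form f <= (1 - k%:R) * spec_min mu E * sqnorm f.
Proof.
move=> k0 mA cE bf fA.
pose F j x := f x * \1_(A `&` c @^-1` [set j]) x.
pose G j x := f x + - k%:R * F j x.
have bF j : bounded_measurable (F j).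
  by apply: bounded_measurableM => //; exact: bounded_measurable_indic.
have bG j : bounded_measurable (G j).
  by apply: bounded_measurableD => //; apply: bounded_measurableM => //;
    exact: bounded_measurable_cst.
have sumF x : \sum_j F j x = f x.
  rewrite -mulr_sumr; have [Ax|/fA->] := pselect (A x); last by rewrite mul0r.
  rewrite (bigD1 (c x))//= big1 => [|j jc].
    by rewrite indicE mem_set// addr0 mulr1.
  by rewrite indicE memNset//= => -[_ /esym]; exact/eqP.
have sumFM a x : \sum_j a * F j x = a * f x by rewrite -mulr_sumr sumF.
have FF j x : F j x ^+ 2 = F j x * f x.
  by rewrite /F indicE; case: (_ \in _); rewrite ?mulr1 ?mulr0 ?mul0r ?expr0n ?expr2.
have [D [N [mN N0 DN]]] := ae_finite_degree dE.
(* The sum is [k <T f, f> - 2 k <T f, f> + k^2 \sum_j <T F_j, F_j>], where the last term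
   vanishes. *)
have formG : \sum_j form (G j) = - k%:R * form f.
  have iG j : ae_integrable mu (fun x => adj_op E (G j) x * G j x).
    exact: ae_integrable_form.
  have [_ <-] := integral_ae_sum iG.
  rewrite -integral_aeZ; last exact: ae_integrable_form.
  apply: (eq_integral_ae mN N0) => x /DN[s [sE _ adjE]].
  have adjG j : adj_op E (G j) x = adj_op E f x - k%:R * adj_op E (F j) x.
    by rewrite !adjE big_split/= -mulr_sumr mulNr.
  (* If [x] is in [A] with colour [j], no neighbour of [x] in [A] has colour [j], so [F j] vanishes
     at every neighbour. *)
  have adjF j : adj_op E (F j) x * F j x = 0.
    have [[Ax cx]|nAx] := pselect ((A `&` c @^-1` [set j]) x); last first.
      by rewrite /F indicE memNset// mulr0 mulr0.
    rewrite adjE big_seq big1 ?mul0r// => y /sE Exy.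
    rewrite /F indicE memNset ?mulr0// => -[Ay cy].
    by apply: (cE x y) => //; rewrite cx cy.
  have sum_adjF : \sum_j adj_op E (F j) x = adj_op E f x.
    under eq_bigr do rewrite adjE.
    by rewrite exchange_big adjE; apply: eq_bigr => y _; exact: sumF.
  transitivity (\sum_j (adj_op E f x * f x - k%:R * adj_op E f x * F j x
      - k%:R * f x * adj_op E (F j) x)).
    apply: eq_bigr => j _; rewrite adjG /G.
    have := adjF j; move: (adj_op E (F j) x) (F j x) => a b ab.
    transitivity (adj_op E f x * f x - k%:R * adj_op E f x * b
      - k%:R * f x * a + k%:R ^+ 2 * (a * b)); first by ring.
    by rewrite ab mulr0 addr0.
  rewrite !big_split/= !sumrN sumr_const card_ord sumFM -mulr_sumr sum_adjF.
  by rewrite -mulr_natl; ring.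
(* The coefficient is [k - 2 k + k^2], since [F_j^2 = F_j f] and the [F_j] add up to [f]. *)
have normG : \sum_j sqnorm (G j) = (k%:R ^+ 2 - k%:R) * sqnorm f.
  have iG j : ae_integrable mu (fun x => G j x ^+ 2).
    by under eq_fun do rewrite expr2; apply: ae_integrable_bm; exact: bounded_measurableM.
  have [_ <-] := integral_ae_sum iG.
  rewrite -integral_aeZ; last first.
    by under eq_fun do rewrite expr2; apply: ae_integrable_bm; exact: bounded_measurableM.
  apply: eq_Rintegral => x _.
  transitivity (\sum_j (f x ^+ 2 + (k%:R ^+ 2 - 2 * k%:R) * f x * F j x)).
    apply: eq_bigr => j _; rewrite /G.
    transitivity (f x ^+ 2 - 2 * k%:R * f x * F j x + k%:R ^+ 2 * F j x ^+ 2).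
      by ring.
    by rewrite FF; ring.
  rewrite big_split/= sumr_const card_ord sumFM.
  by rewrite -mulr_natl; ring.
have : \sum_j (spec_min mu E * sqnorm (G j)) <= \sum_j form (G j).
  by apply: ler_sum => j _; have /andP[] := form_bounds (bG j) lbR ubR.
rewrite -mulr_sumr formG normG.
have k0' : 0 < (k%:R : R) by rewrite ltr0n.
move=> h; rewrite -(ler_pM2l k0'); lra.
Qed.

Lemma form1_ge0 : 0 <= form (fun _ : X => 1).
Proof.
have [D [N [mN N0 DN]]] := ae_finite_degree dE.
have b1 := @bounded_measurable_cst _ X R 1.
rewrite -[leLHS](integral_cst_proba 0).
apply: (le_integral_ae mN N0).
- by apply: ae_integrable_bm; exact: bounded_measurable_cst.
- exact: ae_integrable_form.
- by move=> x /DN[s [_ _ ->]]; rewrite mulr1; exact: sumr_ge0.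
Qed.

Lemma sqnorm1 : sqnorm (fun _ : X => 1) = 1.
Proof. by under eq_Rintegral do rewrite expr1n; rewrite integral_cst_proba. Qed.

(** Test on the constant 1, which has norm 1 and a nonnegative form. *)
Lemma spec_max_ge0 : 0 <= spec_max mu E.
Proof.
have /andP[_] := form_bounds (@bounded_measurable_cst _ X R 1) lbR ubR.
by rewrite sqnorm1 mulr1; exact/le_trans/form1_ge0.
Qed.

(** With [h = t 1_B + 1/t] and [B] the complement of [A], the bound [f(y) f(x) <= (f 1_A)(y) (f
    1_A)(x) + C^2 h(y) h(x)] holds for all [x] and [y]. Summing over neighbours and integrating
    leaves the form at [h], which is at most [M |h|^2]. *)
Lemma form_approx f (A : set X) (t C : R) : 0 < t -> measurable A ->
  measurable_fun setT f -> (forall x, `|f x| <= C) ->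
  form f <= form (fun x => f x * \1_A x) +
   C ^+ 2 * (spec_max mu E * (2 * t ^+ 2 * fine (mu (~` A)) + 2 * t ^- 2)).
Proof.
move=> t0 mA mf fC; pose B := ~` A; have mB : measurable B by exact: measurableC.
have bf : bounded_measurable f by split => //; exists C.
have bA := @bounded_measurable_indic _ _ R _ mA.
have bB := @bounded_measurable_indic _ _ R _ mB.
have bfA := bounded_measurableM bf bA.
pose h x : R := t * \1_B x + t^-1.
have bh : bounded_measurable h.
  apply: bounded_measurableD; last exact: bounded_measurable_cst.
  by apply: bounded_measurableM => //; exact: bounded_measurable_cst.
have [D [N [mN N0 DN]]] := ae_finite_degree dE.
have indA x : (\1_A x : R) = 1 - \1_B x.
  by rewrite !indicE in_setC; case: (x \in A) => /=; rewrite ?subr0 ?subrr.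
have B01 x : (\1_B x : R) = 0 \/ (\1_B x : R) = 1.
  by rewrite indicE; case: (x \in B); [right|left].
have C0 : 0 <= C by exact: le_trans (normr_ge0 _) (fC point).
have ih : ae_integrable mu (fun x => C ^+ 2 * (adj_op E h x * h x)).
  by apply: ae_integrableZ; exact: ae_integrable_form.
have ifA := ae_integrable_form sX bE dE bfA bfA.
apply: (@le_trans _ _ (form (fun x => f x * \1_A x) + C ^+ 2 * form h)).
  rewrite -integral_aeZ; last exact: ae_integrable_form.
  rewrite -integral_aeD//.
  apply: (le_integral_ae mN N0); first exact: ae_integrable_form.
    exact: ae_integrableD.
  move=> x /DN[s [_ _ adjE]]; rewrite !adjE !mulr_suml mulr_sumr -big_split/=.
  apply: ler_sum => y _.
  have fyx : f y * f x <= C ^+ 2.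
    by rewrite (le_trans (ler_norm _))// normrM expr2 ler_pM.
  have tV0 : 0 < t^-1 by rewrite invr_gt0.
  have ttV : t * t^-1 = 1 by rewrite divff// gt_eqF.
  have CC : 0 <= C ^+ 2 by exact: sqr_ge0.
  rewrite !indA /h; set v := t^-1 in tV0 ttV *.
  have key w : 1 <= w -> f y * f x <= C ^+ 2 * w.
    by move=> w1; rewrite (le_trans fyx)// ler_peMr.
  (* With both points in [A] the products of [f] agree and the error term is nonnegative. Otherwise
     [h(y) h(x) >= 1]: it is [1 + 1/t^2] if one point is in [B], and [(t + 1/t)^2] if both are. *)
  have [->|->] := B01 y; have [->|->] := B01 x;
    rewrite ?(subr0, subrr, mulr1, mulr0, add0r, addr0, mul0r).
  - by rewrite lerDl mulr_ge0// mulr_ge0// ltW.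
  - by apply: key; rewrite mulrDr [v * t]mulrC ttV lerDl mulr_ge0// ltW.
  - by apply: key; rewrite mulrDl ttV lerDl mulr_ge0// ltW.
  - apply: key; have -> : (t + v) * (t + v) = t ^+ 2 + v ^+ 2 + 2 * (t * v) by ring.
    by rewrite ttV; have := sqr_ge0 t; have := sqr_ge0 v; lra.
rewrite lerD2l ler_wpM2l ?sqr_ge0//.
have /andP[_ /le_trans] := form_bounds bh lbR ubR; apply.
have M0 := spec_max_ge0.
apply: ler_wpM2l => //.
have iB : ae_integrable mu (\1_B : X -> R) by exact: ae_integrable_bm.
have i1 : ae_integrable mu (fun=> 2 * t ^- 2 : R).
  by apply: ae_integrable_bm; exact: bounded_measurable_cst.
have muB : integral (\1_B : X -> R) = fine (mu B).
  by rewrite /Rintegral integral_indic// setIT.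
have -> : 2 * t ^- 2 = integral (fun _ : X => 2 * t ^- 2).
  by rewrite integral_cst_proba.
rewrite -muB -integral_aeZ// -integral_aeD//; last exact: ae_integrableZ.
apply: (le_integral_ae measurable0 (measure0 _)).
- under eq_fun do rewrite expr2.
  by apply: ae_integrable_bm; exact: bounded_measurableM.
- by apply: ae_integrableD => //; exact: ae_integrableZ.
(* This is [(a + b)^2 <= 2 a^2 + 2 b^2] with [a = t 1_B] and [b = 1/t]. *)
move=> x _; rewrite /h -exprVn; have := sqr_ge0 (t - t^-1).
by have [->|->] := B01 x; move: (t^-1) => v; nra.
Qed.

End ColoredForm.

(** * Truncation: from bounded to square-integrable functions *)

Section Truncation.
Context (d : measure_display) (X : measurableType d) (R : realType)
  (mu : probability X R) (E : X -> X -> Prop).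
Hypothesis sX : standard_borel X R.
Hypothesis bE : borel_graph E.
Hypothesis dE : bounded_degree mu E.
Implicit Types f g h : X -> R.

Local Notation integral u := (Rintegral mu setT u).
Local Notation form f := (integral (fun x => adj_op E f x * f x)).
Local Notation sqnorm f := (integral (fun x => f x ^+ 2)).

Definition truncate (n : nat) f x : R := if `|f x| <= n%:R then f x else 0.

Lemma le_truncate m n f x : (forall x, 0 <= f x) -> (m <= n)%N ->
  0 <= truncate m f x <= truncate n f x.
Proof.
move=> f0 mn; rewrite /truncate; case: ifPn => [fm|_].
  by rewrite (le_trans fm) ?ler_nat// lexx f0.
by rewrite lexx/=; case: ifP.
Qed.

Lemma truncate_id f x : exists n0, forall n, (n0 <= n)%N -> truncate n f x = f x.
Proof.
exists (Num.truncn `|f x|).+1 => n n0; rewrite /truncate ifT//.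
by rewrite (le_trans (ltW (truncnS_gt _)))// ler_nat.
Qed.

Lemma bounded_measurable_truncate n f :
  measurable_fun setT f -> bounded_measurable (truncate n f).
Proof.
move=> mf; split.
  apply: measurable_fun_ifT => //; apply: measurable_fun_ler => //.
  exact: measurableT_comp.
by exists n%:R => x; rewrite /truncate; case: ifP => //; rewrite normr0.
Qed.

(** Only finitely many values of [f] enter at [x], so the largest of their thresholds serves for
    all. *)
Lemma adj_op_truncate (D : nat) f x : (exists s : seq X,
    [/\ forall y, y \in s -> E x y, (size s <= D)%N &
        forall f, adj_op E f x = \sum_(y <- s) f y]) ->
  exists n0, forall n, (n0 <= n)%N ->
    adj_op E (truncate n f) x * truncate n f x = adj_op E f x * f x.
Proof.
move=> [s [_ _ adjE]]; have /choice[m mP] := truncate_id f.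
exists (maxn (m x) (\max_(y <- s) m y)) => n; rewrite geq_max => /andP[xn sn].
rewrite mP// !adjE; congr (_ * _); rewrite !big_seq; apply: eq_bigr => y ys.
by rewrite mP// (leq_trans _ sn)// leq_bigmax_seq.
Qed.

(** The bound is first applied to truncations of [|f|]: monotone convergence shows that [T|f| |f|]
    is integrable. This function dominates the forms of the truncations of [f], and dominated
    convergence concludes. *)
Lemma form_le_of_bounded (K : R) f :
  (forall g, bounded_measurable g -> form g <= K * sqnorm g) -> 0 <= K ->
  measurable_fun setT f -> mu.-integrable setT (fun x => (f x ^+ 2)%:E) ->
  form f <= K * sqnorm f.
Proof.
move=> formK K0 mf if2; pose a x : R := `|f x|.
have ma : measurable_fun setT a by exact: measurableT_comp.
have [D [N0 [mN0 N00 DN0]]] := ae_finite_degree dE.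
have bt n := bounded_measurable_truncate n mf.
have ba n := bounded_measurable_truncate n ma.
have /choice[N1 N1P] n := ae_integrable_form sX bE dE (bt n) (bt n).
have /choice[N2 N2P] n := ae_integrable_form sX bE dE (ba n) (ba n).
have [N3 [mN3 N30 m3]] := ae_measurableM (ae_measurable_adj_op sX bE dE mf) mf.
have [N4 [mN4 N40 m4]] := ae_measurableM (ae_measurable_adj_op sX bE dE ma) ma.
(* One null set gathers all the exceptional sets, so that both limit theorems run on its complement
   [Y]. *)
pose N := N0 `|` (\bigcup_n N1 n `|` \bigcup_n N2 n) `|` (N3 `|` N4).
have mN : measurable N.
  by do ?apply: measurableU => //; apply: bigcupT_measurable => n;
    [have [] := N1P n|have [] := N2P n].
have NN0 : mu N = 0%E.
  apply/negligibleP => //; apply: negligibleU; apply: negligibleU;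
    try exact/negligibleP.
  apply: negligibleU; apply: negligible_bigcup => n.
    by have [? ? _] := N1P n; exact/negligibleP.
  by have [? ? _] := N2P n; exact/negligibleP.
pose Y := ~` N; have mY : measurable Y by exact: measurableC.
have YS (M : set X) : M `<=` N -> Y `<=` ~` M by exact: subsetC.
have int1 n : mu.-integrable Y (fun x =>
    (adj_op E (truncate n f) x * truncate n f x)%:E).
  have [mN1 _ i1] := N1P n; apply: integrableS i1 => //; first exact: measurableC.
  by apply: YS => x Nx; left; right; left; exists n.
have int2 n : mu.-integrable Y (fun x =>
    (adj_op E (truncate n a) x * truncate n a x)%:E).
  have [mN2 _ i2] := N2P n; apply: integrableS i2 => //; first exact: measurableC.
  by apply: YS => x Nx; left; right; right; exists n.
have YD x : Y x -> exists s : seq X,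
    [/\ forall y, y \in s -> E x y, (size s <= D)%N &
        forall f, adj_op E f x = \sum_(y <- s) f y].
  by move=> Yx; apply: DN0; apply: YS Yx => z; left; left.
have mY3 : measurable_fun Y (fun x => adj_op E f x * f x).
  by apply: measurable_funS m3; [exact: measurableC|apply: YS => x; right; left].
have mY4 : measurable_fun Y (fun x => adj_op E a x * a x).
  by apply: measurable_funS m4; [exact: measurableC|apply: YS => x; right; right].
have a0 x : 0 <= a x by exact: normr_ge0.
have Qtr g n : measurable_fun setT g -> (forall x, `|g x| = a x) ->
    sqnorm (truncate n g) <= sqnorm f.
  move=> mg ga; have le_sq x : truncate n g x ^+ 2 <= f x ^+ 2.
    rewrite -[leLHS]real_normK ?num_real// -[leRHS]real_normK ?num_real//.
    rewrite ler_pXn2r ?nnegrE// -/(a x) -ga /truncate.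
    by case: ifP => // _; rewrite normr0.
  apply: le_Rintegral => //.
  apply: (@le_integrable _ _ _ _ _ measurableT _ (fun x => (f x ^+ 2)%:E)) => //.
    apply/measurable_EFinP; apply: measurable_funX.
    by have [] := bounded_measurable_truncate n mg.
  by move=> x _ /=; rewrite lee_fin !ger0_norm// sqr_ge0.
have formE g : mu.-integrable Y (fun x => (adj_op E g x * g x)%:E) ->
    (\int[mu]_(x in Y) (adj_op E g x * g x)%:E)%E = (form g)%:E.
  move=> ig; rewrite (Rintegral_setC_null _ mN NN0) /Rintegral fineK//.
  exact: integrable_fin_num.
have le1 n : (\int[mu]_(x in Y) (adj_op E (truncate n f) x * truncate n f x)%:E
    <= (K * sqnorm f)%:E)%E.
  rewrite formE// lee_fin (le_trans (formK _ (bt n)))// ler_wpM2l//.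
  exact: Qtr.
have le2 n : (\int[mu]_(x in Y) (adj_op E (truncate n a) x * truncate n a x)%:E
    <= (K * sqnorm f)%:E)%E.
  rewrite formE// lee_fin (le_trans (formK _ (ba n)))// ler_wpM2l//.
  by apply: Qtr => // x; rewrite ger0_norm.
have cvgY g x : Y x -> (adj_op E (truncate n g) x * truncate n g x)%:E @[n --> \oo]
    --> (adj_op E g x * g x)%:E.
  move=> /YD/(adj_op_truncate g)[n0 n0P]; apply: cvg_near_cst.
  by exists n0 => // n /= /n0P ->.
have inta : mu.-integrable Y (fun x => (adj_op E a x * a x)%:E).
  have adj0 n x : Y x -> 0 <= adj_op E (truncate n a) x * truncate n a x.
    move=> /YD[s [_ _ ->]]; rewrite mulr_ge0//; last first.
      by have /andP[] := le_truncate x a0 (leqnn n).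
    by apply: sumr_ge0 => y _; have /andP[] := le_truncate y a0 (leqnn n).
  have adja0 x : Y x -> 0 <= adj_op E a x * a x.
    by move=> /YD[s [_ _ ->]]; rewrite mulr_ge0// sumr_ge0.
  apply/integrableP; split; first exact/measurable_EFinP.
  apply: (@le_lt_trans _ _ (K * sqnorm f)%:E); last exact: ltry.
  (* Truncations of [a >= 0] increase with [n], hence so do these products, and their integrals stay
     below [K |f|^2]. *)
  pose G n x := (adj_op E (truncate n a) x * truncate n a x)%:E.
  have cvG : (\int[mu]_(x in Y) G n x @[n --> \oo] -->
      \int[mu]_(x in Y) limn (G ^~ x))%E.
    apply: cvg_monotone_convergence => //.
    - by move=> n; exact: measurable_int (int2 n).
    - move=> x Yx m n mn; rewrite /G lee_fin; have [s [_ _ adjE]] := YD _ Yx.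
      rewrite !adjE; apply: ler_pM.
      + by apply: sumr_ge0 => y _; have /andP[] := le_truncate y a0 (leqnn m).
      + by have /andP[] := le_truncate x a0 (leqnn m).
      + by apply: ler_sum => y _; have /andP[] := le_truncate y a0 mn.
      + by have /andP[] := le_truncate x a0 mn.
  rewrite (eq_integral (fun x => limn (G ^~ x))).
    by apply: (cvge_to_le cvG); exact: nearW.
  move=> x; rewrite inE => Yx.
  by rewrite gee0_abs ?lee_fin ?adja0//; apply/esym/cvg_lim => //; exact: cvgY.
have dom x n : Y x -> (`|(adj_op E (truncate n f) x * truncate n f x)%:E|
    <= (adj_op E a x * a x)%:E)%E.
  move=> /YD[s [_ _ adjE]]; rewrite /= lee_fin normrM !adjE.
  have tr y : `|truncate n f y| <= a y.
    by rewrite /truncate; case: ifP; rewrite // normr0.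
  apply: ler_pM => //; apply: le_trans (ler_norm_sum _ _ _) _.
  exact: ler_sum.
have [intf _ cvgf] := dominated_convergence mY (fun n => measurable_int _ (int1 n))
  ((measurable_EFinP _ _).2 mY3) (aeW _ (cvgY f)) inta (aeW _ dom).
rewrite -lee_fin -formE//; apply: (cvge_to_le cvgf); exact: nearW.
Qed.


End Truncation.

(** * Approximate colourings *)

Section Main.
Context (d : measure_display) (X : measurableType d) (R : realType)
  (mu : probability X R) (E : X -> X -> Prop).

(** Colour classes agree with Borel sets up to null sets. Removing these finitely many null sets
    from the coloured set makes the classes Borel and leaves its measure unchanged. *)
Lemma approx_colorable_borel (k : nat) (e : R) : approx_colorable mu E k -> 0 < e ->
  exists (A : set X) (c : X -> 'I_k), [/\ measurable A, fine (mu (~` A)) < e,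
    forall j, measurable (A `&` c @^-1` [set j]) &
    forall x y, A x -> A y -> E x y -> c x <> c y].
Proof.
move=> /[apply] -[A0 [mA0 [muA0 [c [mc cE]]]]].
have /choice[B /choice[N BN]] := mc.
pose M := \big[setU/set0]_j N j.
have mM : measurable M.
  by apply: bigsetU_measurable => j _; have [_ []] := BN j.
have M0 : mu M = 0%E.
  apply/negligibleP => //; apply: (big_ind (negligible mu)).
  - exact: negligible_set0.
  - by move=> S T; exact: negligibleU.
  - by move=> j _; have [_ [mN [N0 _]]] := BN j; apply/negligibleP.
have NM j : N j `<=` M by rewrite /M (bigD1 j)//=; exact: subsetUl.
exists (A0 `\` M), c; split.
- exact: measurableD.
- have mC := measurableC mA0.
  rewrite setCD; apply: le_lt_trans (_ : fine (mu (~` A0)) < e).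
    apply: fine_le; rewrite ?fin_num_measure//; first exact: measurableU.
    have := @measureU2 _ _ _ mu _ _ mC mM.
    by rewrite [X in (_ + X)%E](_ : _ = 0%E) ?adde0//; exact: M0.
  have : (mu (~` A0) = 1 - mu A0)%E by exact: probability_setC.
  move=> ->; rewrite fineB ?fin_num_measure//=.
  by rewrite ltrBlDr addrC -ltrBlDr.
- move=> j; rewrite (_ : _ `&` _ = B j `\` M).
    by apply: measurableD => //; have [] := BN j.
  have [_ [_ [_ sN]]] := BN j.
  apply/seteqP; split=> x.
    move=> [[Ax nM] cx]; split => //; apply: contrapT => nB; apply: nM.
    by apply: (NM j); apply: sN; left.
  move=> [Bx nM]; have [Ax cx] : (A0 `&` c @^-1` [set j]) x.
    by apply: contrapT => nA; apply: nM; apply: (NM j); apply: sN; right.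
  by [].
- by move=> x y [Ax _] [Ay _]; exact: cE.
Qed.

Hypothesis sX : standard_borel X R.
Hypothesis bE : borel_graph E.
Hypothesis dE : bounded_degree mu E.
Hypothesis lbR : has_lbound (rayleigh_quotients mu E).
Hypothesis ubR : has_ubound (rayleigh_quotients mu E).

Local Notation integral u := (Rintegral mu setT u).
Local Notation form f := (integral (fun x => adj_op E f x * f x)).
Local Notation sqnorm f := (integral (fun x => f x ^+ 2)).

(** A separate [K >= 0] replaces [(1 - k) m], whose sign is unknown, because passing from
    [|f 1_A|^2] to [|f|^2] needs a nonnegative factor. *)
Lemma form_approx_colorable (k : nat) (K : R) (f : X -> R) : (0 < k)%N ->
  approx_colorable mu E k -> 0 <= K -> (1 - k%:R) * spec_min mu E <= K ->
  bounded_measurable f -> form f <= K * sqnorm f.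
Proof.
move=> k0 kE K0 mK bf; have [mf [C fC]] := bf.
have M0 := spec_max_ge0 sX bE dE lbR ubR.
apply/ler_addgt0Pr => e e0.
pose c0 := C ^+ 2 * spec_max mu E.
have c00 : 0 <= c0 by rewrite mulr_ge0// sqr_ge0.
(* With [mu(~A) < t^-4], the error is at most [4 c0 t^-2], hence at most [4 c0 / t] as [t >= 1];
   this [t] makes the latter at most [e]. *)
pose t := 1 + 4 * c0 / e.
have t1 : 1 <= t by rewrite lerDl; apply: divr_ge0; [exact: mulr_ge0|exact: ltW].
have t0 : 0 < t by rewrite (lt_le_trans _ t1).
have tV0 : 0 < t^-1 by rewrite invr_gt0.
have [A [c [mA muA mcA cE]]] := approx_colorable_borel kE (exprn_gt0 4 tV0).
have bfA := bounded_measurableM bf (@bounded_measurable_indic _ _ R _ mA).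
apply: le_trans (form_approx sX bE dE lbR ubR t0 mA mf fC) _.
apply: lerD.
  apply: le_trans (form_colored sX bE dE lbR ubR k0 mcA cE bfA _) _.
    by move=> x nA; rewrite indicE memNset// mulr0.
  apply: (@le_trans _ _ (K * sqnorm (fun x => f x * \1_A x))).
    by rewrite ler_wpM2r// Rintegral_ge0// => x _; exact: sqr_ge0.
  rewrite ler_wpM2l//; apply: (@le_integral_ae _ _ _ _ set0) => //.
  - by under eq_fun do rewrite expr2; apply: ae_integrable_bm; exact: bounded_measurableM.
  - by under eq_fun do rewrite expr2; apply: ae_integrable_bm; exact: bounded_measurableM.
  - move=> x _; rewrite indicE; case: (_ \in _); rewrite ?mulr1// mulr0 expr0n.
    exact: sqr_ge0.
rewrite mulrA -/c0 -exprVn; set v := t^-1.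
have tv : t * v = 1 by rewrite divff// gt_eqF.
set s := fine _ in muA *.
have ts : t ^+ 2 * s <= v ^+ 2.
  apply: (@le_trans _ _ (t ^+ 2 * v ^+ 4)).
    by rewrite ler_wpM2l ?sqr_ge0// ltW.
  have -> : t ^+ 2 * v ^+ 4 = (t * v) ^+ 2 * v ^+ 2 by ring.
  by rewrite tv expr1n mul1r.
apply: (@le_trans _ _ (c0 * (4 * v ^+ 2))).
  by rewrite ler_wpM2l//; lra.
have v1 : v <= 1 by rewrite invf_le1.
have vv : v ^+ 2 <= v by rewrite expr2 ler_piMr// ltW.
apply: (@le_trans _ _ (4 * c0 * v)).
  by rewrite mulrA [c0 * 4]mulrC ler_wpM2l// mulr_ge0.
rewrite -/(4 * c0 / t) ler_pdivrMr// /t mulrDr mulr1 [e * _]mulrC divfK ?gt_eqF//.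
by rewrite lerDr ltW.
Qed.

End Main.

Theorem theorem6p7 (d : measure_display) (X : measurableType d) (R : realType)
  (mu : probability X R) (E : X -> X -> Prop) :
  standard_borel X R ->
  borel_graph E -> bounded_degree mu E -> pmp mu E ->
  forall k : nat, approx_colorable mu E k ->
    (Num.ceil (1 - spec_max mu E / spec_min mu E) <= k%:Z)%R.
Proof.
move=> sX bE dE _ k kE; rewrite ceil_le_int.
have k0 : (0 < k)%N.
  (* A colouring is defined on all of [X], in particular at [point], so ['I_k] is inhabited. *)
  have [A [c _]] := approx_colorable_borel kE ltr01.
  exact: leq_ltn_trans (ltn_ord (c point)).
have k1 : 1 <= (k%:R : R) by rewrite ler1n.
have Rn0 : rayleigh_quotients mu E !=set0.
  exists (Rintegral mu setT (fun x => adj_op E (fun=> 1) x * 1) /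
       Rintegral mu setT (fun _ : X => 1 ^+ 2)), (fun=> 1) => //; split => //.
  split; first exact: finite_measure_integrable_cst.
  move=> [N [mN N0 N1]]; have NT : N = setT.
    by rewrite -subTset => x _; apply: N1 => /eqP; rewrite oner_eq0.
  move: N0; rewrite NT [X in X = _]probability_setT => /eqP.
  by rewrite onee_eq0.
(* In either unbounded case the quotient is 0 and the claim reads [1 <= k]. *)
have [lbR|nlb] := pselect (has_lbound (rayleigh_quotients mu E)); last first.
  by rewrite /spec_min inf_out ?invr0 ?mulr0 ?subr0// => -[].
have [ubR|nub] := pselect (has_ubound (rayleigh_quotients mu E)); last first.
  by rewrite /spec_max sup_out ?mul0r ?subr0// => -[].
set m := spec_min mu E; set M := spec_max mu E.
have formK (K : R) : 0 <= K -> (1 - k%:R) * m <= K -> M <= K.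
  move=> K0 mK; apply: ge_sup => // _ [f [mf [if2 nf0]] <-].
  have Q0 : 0 < Rintegral mu setT (fun x => f x ^+ 2).
    rewrite lt_def Rintegral_ge0 ?andbT; last by move=> x _; exact: sqr_ge0.
    by apply/eqP => /(sqnorm_eq0 mf if2).
  rewrite ler_pdivrMr//; apply: form_le_of_bounded => // g bg.
  exact: (form_approx_colorable sX bE dE lbR ubR k0 kE K0 mK bg).
(* For [m < 0] take [K = (1 - k) m] and divide by [m]. For [m > 0] the choice [K = 0] gives
   [M <= 0 < m], against [m <= M]. For [m = 0] division by zero gives 0, leaving [1 <= k]. *)
have [m0|m0|m0] := ltgtP m 0.
- have K0 : 0 <= (1 - k%:R) * m by rewrite mulr_le0 ?subr_le0// ltW.
  have := formK _ K0 (lexx _); rewrite -[leLHS](@divfK _ m) ?lt_eqF//.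
  by rewrite ler_nM2r// -pmulrn lerBlDr lerBlDl.
- have M0 : M <= 0 by apply: formK => //; rewrite mulr_le0_ge0 ?subr_le0// ltW.
  have [q Rq] := Rn0.
  have : m <= 0 by rewrite (le_trans (ge_inf lbR Rq))// (le_trans (ub_le_sup ubR Rq)).
  by rewrite leNgt m0.
- by rewrite m0 invr0 mulr0 subr0.
Qed.
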